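(* Let $K\in\{\mathbb{R},\mathbb{C}\}$. Suppose $\mathbb{X}$ is a reflexive Banach space over $K$ and $\mathbb{Y}$ is a finite dimensional Banach space over $K$. Suppose $T\in \mathbb{L}(\mathbb{X},\mathbb{Y})$ with $\|T\|=1$, and $\mathcal{W}$ is a finite dimensional subspace of $\mathbb{L}(\mathbb{X},\mathbb{Y})$. Then $T\perp_B \mathcal{W}$ if and only if there exist $h\in\mathbb{N}$ and, for $1\leq i\leq h$, $x_i\in M_T\cap Ext(B_{\mathbb{X}})$, $y_i^*\in Ext(J(Tx_i))$ and real numbers $\lambda_i>0$ such that $\sum_{i=1}^h \lambda_i=1$ and $\sum_{i=1}^h \lambda_i\, y_i^*(Ax_i)=0$ for all $A\in \mathcal{W}$.
   Context: $\mathbb{L}(\mathbb{X},\mathbb{Y})$ is the space of all bounded linear operators from $\mathbb{X}$ to $\mathbb{Y}$ with the operator norm. $B_{\mathbb{X}}=\{x\in\mathbb{X}:\|x\|\leq 1\}$, $S_{\mathbb{X}}=\{x\in\mathbb{X}:\|x\|=1\}$. $Ext(C)$ denotes the set of extreme points of a convex set $C$. $M_T=\{x\in S_{\mathbb{X}}:\|Tx\|=\|T\|\}$. For a nonzero vector $y$ of a Banach space $\mathbb{Y}$, $J(y)=\{f\in S_{\mathbb{Y}^*}: f(y)=\|y\|\}$. Birkhoff-James orthogonality: $T\perp_B A$ means $\|T+\lambda A\|\geq\|T\|$ for all $\lambda\in K$; for a subspace $\mathcal{W}$ of $\mathbb{L}(\mathbb{X},\mathbb{Y})$, $T\perp_B\mathcal{W}$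 means $T\perp_B A$ for all $A\in\mathcal{W}$. *)

(* Defs.v *)
From HB Require Import structures.
From mathcomp Require Import all_boot all_order all_algebra.
From mathcomp Require Import complex.
From mathcomp Require Import all_classical all_reals topology normedtype.

Set Implicit Arguments.
Unset Strict Implicit.
Unset Printing Implicit Defensive.

Import Order.TTheory GRing.Theory Num.Theory.
Import numFieldNormedType.Exports.

Local Open Scope classical_set_scope.
Local Open Scope ring_scope.

(* In R[i], as in MathComp generally, x <= y means that y - x is a nonnegative
   real and norms are scalar-valued.  Hence 0 < t already forces t to be real,
   and all definitions below make sense uniformly for K = R and K = R[i]. *)
Variant real_or_complex (R : realType) : numFieldType -> Prop :=
| RealScalars : real_or_complex R R
| ComplexScalars : real_or_complex R (R[i])%C.

Section LinearSpaces.
Context {K : numFieldType} {V : lmodType K}.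

Definition extreme_points (C : set V) : set V :=
  [set x | C x /\ forall (a b : V) (t : K), C a -> C b -> 0 < t < 1 ->
     x = t *: a + (1 - t) *: b -> a = x /\ b = x].

Definition linear_subspace (W : set V) : Prop :=
  W 0 /\ forall (a : K) (u v : V), W u -> W v -> W (a *: u + v).

Definition finite_dimensional (W : set V) : Prop :=
  exists (n : nat) (e : 'I_n -> V),
    W = [set v | exists c : 'I_n -> K, v = \sum_i c i *: e i].

End LinearSpaces.

Section BoundedOperators.
Context {K : numFieldType}.

Definition is_bounded_linear (X Y : normedModType K) : {pred X -> Y} :=
  fun f => `[< linear f /\ exists M : K, forall x, `|f x| <= M * `|x| >].

Record bounded_op (X Y : normedModType K) := BoundedOp {
  bounded_op_fun :> X -> Y ;
  bounded_opP : bounded_op_fun \in @is_bounded_linear X Y }.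

Section Lmodule.
Variables X Y : normedModType K.

HB.instance Definition _ := [isSub for @bounded_op_fun X Y].
HB.instance Definition _ := [Choice of bounded_op X Y by <:].

Fact is_bounded_linear_submod : submod_closed (@is_bounded_linear X Y).
Proof.
split=> [|a f g /asboolP[lf [M fM]] /asboolP[lg [N gN]]]; apply/asboolP.
  split=> [a x y|]; first by rewrite /= scaler0 addr0.
  by exists 0 => x; rewrite normr0 mul0r.
split=> [b x y|].
  rewrite !fctE lf lg !scalerDr !scalerA (mulrC a b) -!addrA.
  by congr (_ + _); rewrite addrCA.
exists (`|a| * M + N) => x; rewrite mulrDl -mulrA.
apply: le_trans (ler_normD _ _) _; apply: lerD => //.
by rewrite normrZ ler_wpM2l.
Qed.

HB.instance Definition _ :=
  GRing.isSubmodClosed.Build K (X -> Y) (@is_bounded_linear X Y)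
    is_bounded_linear_submod.
HB.instance Definition _ := [SubChoice_isSubLmodule of bounded_op X Y by <:].

Fact bounded_op_is_linear (f : bounded_op X Y) : linear f.
Proof. by case: f => f /= /asboolP[]. Qed.

HB.instance Definition _ (f : bounded_op X Y) :=
  GRing.isLinear.Build K X Y _ f (bounded_op_is_linear f).

End Lmodule.

Definition unit_ball (X : normedModType K) : set X := [set x | `|x| <= 1].
Definition unit_sphere (X : normedModType K) : set X := [set x | `|x| = 1].

Definition opnorm {X Y : normedModType K} (T : bounded_op X Y) : K :=
  supremum 0 [set `|T x| | x in @unit_ball X].

Definition dual (X : normedModType K) : lmodType K := bounded_op X K^o.

(* The bidual is unfolded: phi ranges over the linear functionals on dual X
   that are bounded for opnorm. *)
Definition reflexive_space (X : normedModType K) : Prop :=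
  forall phi : {linear dual X -> K^o},
    (exists M : K, forall f : dual X, `|phi f| <= M * opnorm f) ->
    exists x : X, forall f : dual X, phi f = f x.

Definition norm_attainment {X Y : normedModType K} (T : bounded_op X Y) :
    set X :=
  [set x | @unit_sphere X x /\ `|T x| = opnorm T].

Definition support_functionals {Y : normedModType K} (y : Y) : set (dual Y) :=
  [set f | opnorm f = 1 /\ f y = `|y|].

Definition bj_orthogonal {X Y : normedModType K} (T A : bounded_op X Y) : Prop :=
  forall lambda : K, opnorm T <= opnorm (T + lambda *: A).

Definition bj_orthogonal_to {X Y : normedModType K} (T : bounded_op X Y)
    (W : set (bounded_op X Y)) : Prop :=
  forall A, W A -> bj_orthogonal T A.

End BoundedOperators.

Arguments unit_ball {K} X _.
Arguments unit_sphere {K} X _.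

(* Main.v *)
Require Import Defs.
From HB Require Import structures.
From mathcomp Require Import all_boot all_order all_algebra.
From mathcomp Require Import complex ring lra.
From mathcomp Require Import all_classical all_reals topology normedtype.

Set Implicit Arguments.
Unset Strict Implicit.
Unset Printing Implicit Defensive.

Import Order.TTheory GRing.Theory Num.Theory.
Import numFieldNormedType.Exports.

Local Open Scope classical_set_scope.
Local Open Scope ring_scope.

(* Weak compactness is replaced throughout by duality: a compact convex set is
   presented as the set of linear minorants of a sublinear functional [p].
   Reflexivity says that this describes the ball of [X] (with [p] the norm of
   [X^*]); the dual ball of [Y] is the case where [p] is the norm of [Y].  Faces
   and hyperplane sections of such sets are of the same kind, so Zorn's lemma
   yields extreme points, and Dubins' theorem then matches every minorant, on
   finitely many vectors, with a convex combination of extreme minorants.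

   If [T] is orthogonal to [W], Hahn-Banach gives a mean [F] on the bounded
   functions of the pairs [(x, y)] in [B_X * B_Y^*] with [F (Re y (T x)) = 1] and
   [F (Re y (A x)) = 0] for [A] in [W].  By Dubins, [F] may be replaced by a
   convex combination of extreme means.  These are multiplicative, and since [Y]
   is finite dimensional each of them acts on the functions [Re y (A x)] as the
   evaluation at one pair.  Dubins in [B_Y^*] and then in [B_X] makes the pairs
   extreme. *)

(** * Sublinear functionals and their linear minorants *)

Section Sublinear.
Context {R : realType} {K : nzRingType} (iota : {rmorphism R -> K}).
Context {V : lmodType K}.
Implicit Types (p q f g : V -> R) (M : V -> R -> Prop).

Definition sublinear p : Prop :=
  (forall x y, p (x + y) <= p x + p y) /\
  (forall r x, 0 <= r -> p (iota r *: x) = r * p x).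

Definition real_linear f : Prop :=
  (forall x y, f (x + y) = f x + f y) /\
  (forall r x, f (iota r *: x) = r * f x).

Definition minorants p : set (V -> R) :=
  [set f | real_linear f /\ forall x, f x <= p x].

Definition extreme_minorants p : set (V -> R) :=
  [set f | minorants p f /\ forall f1 f2 (t : R), minorants p f1 ->
     minorants p f2 -> 0 < t < 1 ->
     (forall x, f x = t * f1 x + (1 - t) * f2 x) -> f1 = f].

(** For [r > 0] the hypothesis at [r^-1] gives the reverse inequality. For [r = 0], halving gives
    [p 0 <= 0], and subadditivity gives [p 0 >= 0]. *)
Lemma sublinearW p :
  (forall x y, p (x + y) <= p x + p y) ->
  (forall r x, 0 < r -> p (iota r *: x) <= r * p x) -> sublinear p.
Proof.
move=> pD pZ; split=> // r x; rewrite le_eqVlt => /predU1P[<-|r_gt0].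
  rewrite rmorph0 scale0r mul0r.
  have := pZ 2^-1 0 ltac:(lra); have := pD 0 0; rewrite addr0 scaler0; lra.
apply/eqP; rewrite eq_le pZ //=.
have := pZ r^-1 (iota r *: x); rewrite invr_gt0 scalerA -rmorphM mulVf ?gt_eqF //.
rewrite rmorph1 scale1r => /(_ r_gt0) H.
rewrite -(ler_pM2l (x := r^-1)) ?invr_gt0 // mulrA mulVf ?gt_eqF // mul1r.
exact: H.
Qed.

Lemma sublinear0 p : sublinear p -> p 0 = 0.
Proof. by case=> _ /(_ 0 0 (lexx _)); rewrite scaler0 mul0r. Qed.

Lemma sublinear_lower p x y : sublinear p -> p x - p (- y) <= p (x + y).
Proof.
case=> pD _; rewrite lerBlDr.
by apply: le_trans (pD _ _); rewrite addrK.
Qed.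

Lemma real_linear0 f : real_linear f -> f 0 = 0.
Proof. by case=> _ /(_ 0 0); rewrite scaler0 mul0r. Qed.

Lemma real_linearN f x : real_linear f -> f (- x) = - f x.
Proof.
move=> fl; have [fD _] := fl.
by have := fD x (- x); rewrite subrr real_linear0 //; lra.
Qed.

Lemma real_linear_sum f I (r : seq I) (P : pred I) (F : I -> V) :
  real_linear f -> f (\sum_(i <- r | P i) F i) = \sum_(i <- r | P i) f (F i).
Proof. by move=> fl; apply: big_morph => //; [case: fl|exact: real_linear0]. Qed.

Lemma odd_sublinear_linear p :
  sublinear p -> (forall x, p (- x) <= - p x) -> real_linear p.
Proof.
move=> sp pN; have [pD pZ] := sp.
have pNE x : p (- x) = - p x.
  by have := pN x; have := pD x (- x); rewrite subrr sublinear0 //; lra.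
split=> [x y|r x].
  apply/eqP; rewrite eq_le pD /=.
  by have := pD (- x) (- y); rewrite -opprD !pNE; lra.
have [r_ge0|r_lt0] := leP 0 r; first exact: pZ.
rewrite -[r]opprK rmorphN scaleNr pNE pZ ?oppr_ge0 ?ltW //; lra.
Qed.

Lemma inf_sublinear (A : set (V -> R)) :
  A !=set0 -> (forall x, exists c, forall f, A f -> c <= f x) ->
  (forall f g, A f -> A g ->
     forall x y, exists2 h, A h & h (x + y) <= f x + g y) ->
  (forall f r x, A f -> 0 < r -> exists2 h, A h & h (iota r *: x) <= r * f x) ->
  sublinear (fun x => inf [set f x | f in A]).
Proof.
move=> A0 lbA AD AZ.
have ne x : [set f x | f in A] !=set0.
  by case: A0 => f Af; exists (f x); exists f.
have lb x f : A f -> inf [set f x | f in A] <= f x.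
  move=> Af; apply: ge_inf; last by exists f.
  by have [c cA] := lbA x; exists c => _ [h Ah <-]; exact: cA.
have glb x c : (forall f, A f -> c <= f x) -> c <= inf [set f x | f in A].
  by move=> cA; apply: lb_le_inf => // _ [h Ah <-]; exact: cA.
apply: sublinearW => [x y|r x r_gt0].
  rewrite -lerBlDl; apply: (glb _ _) => g Ag; rewrite lerBlDl -lerBlDr.
  apply: (glb _ _) => f Af; rewrite lerBlDr; have [h Ah hfg] := AD f g Af Ag x y.
  exact: le_trans (lb _ _ Ah) hfg.
rewrite -ler_pdivrMl //; apply: (glb _ _) => f Af; rewrite ler_pdivrMl //.
have [h Ah hf] := AZ f r x Af r_gt0.
exact: le_trans (lb _ _ Ah) hf.
Qed.

(* A cone [M] of pairs [(m, a)], read as constraints [a <= f m] on the minorants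
   [f] of [p]; the condition [a <= p m] makes them satisfiable. *)
Definition constraint_cone p M : Prop :=
  [/\ M 0 0,
      forall x y a b, M x a -> M y b -> M (x + y) (a + b),
      forall r x a, 0 < r -> M x a -> M (iota r *: x) (r * a)
    & forall x a, M x a -> a <= p x].

(** A minorant [f] of [p] with [a <= f m] satisfies [f x = f (x + m) - f m <= p (x + m) - a]. The
    infimum of these bounds is the support function of the constrained set. *)
Definition constrain p M : V -> R := fun x =>
  inf [set f x | f in
    [set f | exists m a, M m a /\ f = fun x => p (x + m) - a]].

Section Constrain.
Context {p : V -> R} {M : V -> R -> Prop}.
Hypotheses (sp : sublinear p) (cM : constraint_cone p M).

Lemma constrain_le x m a : M m a -> constrain p M x <= p (x + m) - a.
Proof.
case: cM => _ _ _ Mp Mma; apply: ge_inf.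
  exists (- p (- x)) => _ [_ [m' [a' [Mma' ->]]] <-].
  by have := sublinear_lower m' x sp; rewrite (addrC m'); have := Mp _ _ Mma'; lra.
by exists (fun x => p (x + m) - a) => //; exists m, a.
Qed.

Lemma constrain_sublinear : sublinear (constrain p M).
Proof.
have [M0 MD MZ Mp] := cM; have [pD pZ] := sp; apply: inf_sublinear.
- by exists (fun x => p (x + 0) - 0); exists 0, 0.
- move=> x; exists (- p (- x)) => _ [m [a [Mma ->]]].
  by have := sublinear_lower m x sp; rewrite (addrC m); have := Mp _ _ Mma; lra.
- move=> _ _ [m [a [Mma ->]]] [n [b [Mnb ->]]] x y.
  exists (fun x => p (x + (m + n)) - (a + b)).
    by exists (m + n), (a + b); split => //; exact: MD.
  by have := pD (x + m) (y + n); rewrite addrACA; lra.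
- move=> _ r x [m [a [Mma ->]]] r_gt0.
  exists (fun x => p (x + iota r *: m) - r * a).
    by exists (iota r *: m), (r * a); split => //; exact: MZ.
  by rewrite -scalerDr pZ ?(ltW r_gt0) // mulrBr.
Qed.

Lemma constrain_leW x : constrain p M x <= p x.
Proof. by case: cM => /(constrain_le x) + _ _ _; rewrite addr0 subr0. Qed.

Lemma constrain_minorants f : minorants (constrain p M) f <->
  minorants p f /\ forall m a, M m a -> a <= f m.
Proof.
split=> [[fl fq]|[[fl fp] Mf]]; split=> //.
- by split=> // x; exact: le_trans (fq x) (constrain_leW x).
- move=> m a /(constrain_le (- m)); rewrite addNr sublinear0 //.
  by have := fq (- m); rewrite real_linearN //; lra.
- have [M0 _ _ _] := cM; move=> x; apply: lb_le_inf.
    by exists (p (x + 0) - 0), (fun x => p (x + 0) - 0) => //; exists 0, 0.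
  move=> _ [_ [m [a [Mma ->]]] <-].
  by have := fp (x + m); have [-> _] := fl; have := Mf _ _ Mma; lra.
Qed.

End Constrain.

(** * Exposed faces, the Krein-Milman theorem and the Hahn-Banach theorem *)

Lemma ray_cone p (g : V) : sublinear p ->
  constraint_cone p (fun x a => exists2 s, 0 <= s & x = iota s *: g /\ a = s * p g).
Proof.
move=> [_ pZ]; split.
- by exists 0; rewrite // rmorph0 scale0r mul0r.
- move=> _ _ _ _ [s s0 [-> ->]] [t t0 [-> ->]]; exists (s + t).
    exact: addr_ge0.
  by rewrite rmorphD scalerDl mulrDl.
- move=> r _ _ r0 [s s0 [-> ->]]; exists (r * s).
    by rewrite mulr_ge0 // ltW.
  by rewrite scalerA rmorphM mulrA.
- by move=> _ _ [s s0 [-> ->]]; rewrite pZ.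
Qed.

Definition face_of p q : Prop :=
  [/\ sublinear q, forall x, q x <= p x & forall f1 f2 (t : R),
     minorants p f1 -> minorants p f2 -> 0 < t < 1 ->
     (forall x, t * f1 x + (1 - t) * f2 x <= q x) ->
     (forall x, f1 x <= q x) /\ (forall x, f2 x <= q x)].

(** The ray constraint cuts out the minorants of [q] with [f g = q g]. If a proper combination
    reaches the maximal value [q g], then so do both of its terms. *)
Lemma face_of_exposed p q (g : V) : face_of p q ->
  face_of p (constrain q (fun x a => exists2 s, 0 <= s &
                                      x = iota s *: g /\ a = s * q g)).
Proof.
move=> [sq qp qface]; set M := fun _ _ => _.
have cM : constraint_cone q M := ray_cone g sq.
split=> [|x|f1 f2 t mf1 mf2 t01 fq].
- exact: constrain_sublinear.
- exact: le_trans (constrain_leW sq cM x) (qp x).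
have [f1q f2q] : (forall x, f1 x <= q x) /\ (forall x, f2 x <= q x).
  apply: (qface _ _ t) => // x.
  exact: le_trans (fq x) (constrain_leW sq cM x).
have [f1l _] := mf1; have [f2l _] := mf2.
have /(constrain_le sq cM (- g)) : M g (q g).
  by exists 1; rewrite ?rmorph1 ?scale1r ?mul1r.
have := fq (- g); rewrite addNr sublinear0 //.
rewrite (real_linearN _ f1l) (real_linearN _ f2l).
move=> h1 h2; have {h1 h2} h : q g <= t * f1 g + (1 - t) * f2 g by lra.
have qf1 : q g <= f1 g by have := f1q g; have := f2q g; nra.
have qf2 : q g <= f2 g by have := f1q g; have := f2q g; nra.
have Mf f : real_linear f -> q g <= f g -> forall m a, M m a -> a <= f m.
  by move=> [_ fZ] qf _ _ [s s0 [-> ->]]; rewrite fZ ler_wpM2l.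
split=> x.
- by have [_] : minorants (constrain q M) f1
    by apply/constrain_minorants => //; split=> //; exact: Mf.
- by have [_] : minorants (constrain q M) f2
    by apply/constrain_minorants => //; split=> //; exact: Mf.
Qed.

(* Krein-Milman: a minimal face, written as the set of minorants of a sublinear
   [q], is exposed in no direction [g], so [q] itself is linear. *)
Lemma extreme_minorant_exists p : sublinear p -> exists f, extreme_minorants p f.
Proof.
move=> sp.
have pp : face_of p p by split=> // f1 f2 t [_ ?] [_ ?] _ _.
pose T := {q | face_of p q}.
(* The order is reversed, so that the maximal element found by Zorn's lemma is a minimal face. *)
pose le (q1 q2 : T) := `[< forall x, sval q2 x <= sval q1 x >].
have [|||A Atot|[q qface] qmin] := @Zorn T le.
- by move=> q; apply/asboolP.
- move=> q r s /asboolP qr /asboolP rs; apply/asboolP => x.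
  exact: le_trans (rs x) (qr x).
- move=> [q hq] [r hr] /asboolP /= qr /asboolP /= rq; apply: eq_exist.
  by apply/funext => x; apply/eqP; rewrite eq_le qr rq.
- have [[q0 Aq0]|A0] := pselect (A !=set0); last first.
    by exists (exist _ p pp) => s As; case: A0; exists s.
  pose B := [set sval q | q in A].
  have lbB x f : B f -> - p (- x) <= f x.
    move=> [[q [sq qp qf]] Aq <-] /=.
    have := sublinear_lower 0 x sq; rewrite add0r sublinear0 //.
    by have := qp (- x); lra.
  have infB x f : B f -> inf [set f x | f in B] <= f x.
    move=> Bf; apply: ge_inf; last by exists f.
    by exists (- p (- x)) => _ [g Bg <-]; exact: lbB.
  have glb x c : (forall f, B f -> c <= f x) -> c <= inf [set f x | f in B].
    move=> cB; apply: lb_le_inf => [|_ [f Bf <-]]; last exact: cB.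
    by exists (sval q0 x), (sval q0) => //; exists q0.
  have qface : face_of p (fun x => inf [set f x | f in B]).
    split=> [|x|f1 f2 t m1 m2 t01 fB].
    + apply: inf_sublinear.
      * by exists (sval q0), q0.
      * by move=> x; exists (- p (- x)) => f; exact: lbB.
      * move=> _ _ [q1 Aq1 <-] [q2 Aq2 <-] x y.
        have [[q1D _] _ _] := svalP q1; have [[q2D _] _ _] := svalP q2.
        (* The smaller of two members of the chain serves for both arguments. *)
        have [/asboolP le12|/asboolP le21] := Atot _ _ Aq1 Aq2.
        - exists (sval q2); first by exists q2.
          by rewrite (le_trans (q2D _ _)) // lerD2r.
        - exists (sval q1); first by exists q1.
          by rewrite (le_trans (q1D _ _)) // lerD2l.
      * move=> _ r x [q Aq <-] r0; exists (sval q); first by exists q.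
        by have [[_ qZ] _ _] := svalP q; rewrite qZ ?(ltW r0).
    + have [_ + _] := svalP q0; move=> /(_ x); apply: le_trans; apply: infB.
      by exists q0.
    + have fq (q : T) : A q ->
          (forall x, f1 x <= sval q x) /\ (forall x, f2 x <= sval q x).
        move=> Aq; have [_ _ qf] := svalP q; apply: (qf _ _ t) => // x.
        by apply: le_trans (fB x) _; apply: infB; exists q.
      by split=> x; apply: (glb _ _) => _ [q /fq[fq1 fq2] <-].
  exists (exist _ _ qface) => s As; apply/asboolP => x /=.
  by apply: infB; exists s.
have [sq qp qf] := qface.
have qlin : real_linear q.
  apply: odd_sublinear_linear => // g.
  have cM := ray_cone g sq.
  (* By minimality, constraining [q] along [g] gives [q] back; the constraint with [s = 1] then
     bounds [q (- g)] by [q 0 - q g]. *)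
  have /(congr1 sval)/= qE := qmin (exist _ _ (face_of_exposed g qface))
    (introT (asboolP _) (constrain_leW sq cM)).
  rewrite -{1}qE.
  have /(constrain_le sq cM (- g)) :
      exists2 s, 0 <= s & g = iota s *: g /\ q g = s * q g.
    by exists 1; rewrite ?rmorph1 ?scale1r ?mul1r.
  by rewrite addNr sublinear0 // sub0r.
exists q; split=> // f1 f2 t m1 m2 t01 qE.
have [f1q _] : (forall x, f1 x <= q x) /\ (forall x, f2 x <= q x).
  by apply: (qf _ _ t) => // x; rewrite qE.
apply/funext => x; apply/eqP; rewrite eq_le f1q /=.
have [f1l _] := m1.
by have := f1q (- x); rewrite !real_linearN // lerN2.
Qed.

(** A form of the Hahn-Banach theorem, deduced from Krein-Milman applied to [constrain p M]. *)
Lemma constrained_minorant p M : sublinear p -> constraint_cone p M ->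
  exists2 f, minorants p f & forall m a, M m a -> a <= f m.
Proof.
move=> sp cM; have [f [/(constrain_minorants sp cM)[mf Mf] _]] :=
  extreme_minorant_exists (constrain_sublinear sp cM).
by exists f.
Qed.

Lemma supporting_minorant p x : sublinear p ->
  exists2 f, minorants p f & f x = p x.
Proof.
move=> sp; have [f mf Mf] := constrained_minorant sp (ray_cone x sp).
exists f => //; apply/eqP; rewrite eq_le; apply/andP; split; first by case: mf.
by apply: Mf; exists 1; rewrite ?rmorph1 ?scale1r ?mul1r.
Qed.

End Sublinear.

(** * Convex hulls and Dubins' theorem *)

(** Combinations are binary, so that inclusions go by induction, and strict, so that the weights in
    [hull_sum] come out positive. *)
Inductive hull {R : realType} {I : Type} (S : set (I -> R)) : set (I -> R) :=
| hull_gen f : S f -> hull S f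
| hull_conv f g (t : R) : hull S f -> hull S g -> 0 < t < 1 ->
    hull S (fun i => t * f i + (1 - t) * g i).

Lemma hull_comp {R : realType} {I J : Type} (u : J -> I)
    (S : set (I -> R)) (S' : set (J -> R)) f :
  (forall f, S f -> hull S' (f \o u)) -> hull S f -> hull S' (f \o u).
Proof.
by move=> SS'; elim=> [g /SS' //|g h t _ ? _ ? t01]; exact: hull_conv.
Qed.

Lemma hull_trans {R : realType} {I : Type} (S S' : set (I -> R)) :
  S `<=` hull S' -> hull S `<=` hull S'.
Proof. by move=> SS' f; exact: (@hull_comp _ _ _ id). Qed.

Lemma hull_const {R : realType} {I : Type} (S : set (I -> R)) i a f :
  (forall f, S f -> f i = a) -> hull S f -> f i = a.
Proof.
by move=> Sa; elim=> [g /Sa //|g h t _ ga _ ha t01]; rewrite ga ha; ring.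
Qed.

Lemma hull_sum {R : realType} {I : Type} (S : set (I -> R)) f : hull S f ->
  exists (n : nat) (e : 'I_n -> I -> R) (c : 'I_n -> R),
    [/\ forall k, S (e k), forall k, 0 < c k, \sum_k c k = 1
      & forall i, f i = \sum_k c k * e k i].
Proof.
elim=> [g Sg|g h t _ [n [e [c [Se c0 c1 gE]]]] _ [m [d [b [Sd b0 b1 hE]]]] t01].
  exists 1%N, (fun=> g), (fun=> 1); split=> // [|i]; rewrite big_ord1 //.
  by rewrite mul1r.
exists (n + m)%N.
exists (fun k => match fintype.split k with inl k => e k | inr k => d k end).
exists (fun k => match fintype.split k with
                 | inl k => t * c k | inr k => (1 - t) * b k end).
have t0 : 0 < t by lra.
have t1 : 0 < 1 - t by lra.
split=> [k|k||i].
- by case: (fintype.split k).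
- by case: (fintype.split k) => j; rewrite mulr_gt0.
- rewrite big_split_ord /=.
  under eq_bigr do rewrite (unsplitK (inl _)).
  under [X in _ + X]eq_bigr do rewrite (unsplitK (inr _)).
  by rewrite -!mulr_sumr c1 b1; ring.
- rewrite gE hE !mulr_sumr big_split_ord /=; congr (_ + _).
    by apply: eq_bigr => k _; rewrite (unsplitK (inl _)) mulrA.
  by apply: eq_bigr => k _; rewrite (unsplitK (inr _)) mulrA.
Qed.

Section Dubins.
Context {R : realType} {K : nzRingType} (iota : {rmorphism R -> K}).
Context {V : lmodType K}.
Implicit Types (p q f D : V -> R).

Local Notation real_linear := (real_linear iota).
Local Notation minorants := (minorants iota).
Local Notation extreme_minorants := (extreme_minorants iota).

Lemma real_linear_axpy f D (r : R) : real_linear f -> real_linear D ->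
  real_linear (fun x => f x + r * D x).
Proof.
by move=> [fD fZ] [DD DZ]; split=> *; rewrite ?fD ?DD ?fZ ?DZ; ring.
Qed.

(** The admissible [s] form a closed set containing [0]. It is bounded above because [D x > 0] for
    some [x], so its supremum is attained. *)
Lemma minorants_line_end p f D : minorants p f -> real_linear D ->
  (exists x, D x != 0) -> exists s, [/\ 0 <= s,
    minorants p (fun x => f x + s * D x) &
    forall s', 0 <= s' -> minorants p (fun x => f x + s' * D x) -> s' <= s].
Proof.
move=> [fl fp] Dl [x0 Dx0].
pose E := [set s | 0 <= s /\ minorants p (fun x => f x + s * D x)].
have E0 : E 0.
  by split=> //; split=> [|x]; [exact: real_linear_axpy|rewrite mul0r addr0].
have [x Dx] : exists x, 0 < D x.
  have [Dx0'|Dx0'|/eqP] := ltgtP (D x0) 0; last by rewrite (negPf Dx0).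
    by exists (- x0); rewrite (real_linearN _ Dl) oppr_gt0.
  by exists x0.
have ubE : has_ubound E.
  exists ((p x - f x) / D x) => s [_ [_ /(_ x)]] /= fsp.
  by rewrite ler_pdivlMr //; lra.
exists (sup E); split.
- exact: ub_le_sup.
- split=> [|y]; first exact: real_linear_axpy.
  rewrite leNgt; apply/negP => pf.
  have [Dy|Dy] := leP (D y) 0.
    have : 0 <= sup E by exact: ub_le_sup.
    by have := fp y; nra.
  have [s [_ [_ /(_ y) /= fs]]] : exists2 s, E s & (p y - f y) / D y < s.
    by apply: sup_gt; [exists 0|rewrite ltr_pdivrMr //; lra].
  by rewrite ltr_pdivrMr //; lra.
- by move=> s' s'0 ms'; apply: ub_le_sup.
Qed.

(* If [c], [d] moved the end point [f + s D] off its line, then [f] would be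
   interior to the triangle [c], [d], [f - s' D], which meets the hyperplane
   [g] in a segment around [f]. *)
Lemma line_end_extreme p f D (g : V) (s s' : R) :
  (forall f1 f2 (t : R), minorants p f1 -> minorants p f2 -> f1 g = f g ->
     f2 g = f g -> 0 < t < 1 -> (forall x, f x = t * f1 x + (1 - t) * f2 x) ->
     f1 = f) ->
  real_linear D -> (exists x, D x != 0) -> 0 < s -> 0 < s' ->
  minorants p (fun x => f x + s * D x) ->
  (forall r, 0 <= r -> minorants p (fun x => f x + r * D x) -> r <= s) ->
  minorants p (fun x => f x - s' * D x) ->
  extreme_minorants p (fun x => f x + s * D x).
Proof.
move=> fext Dl [x0 Dx0] s0 s'0 ma smax mb; split=> // c d v mc md v01 aE.
have cdl : real_linear (fun x => c x + (-1) * d x).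
  by apply: real_linear_axpy; [case: mc|case: md].
(* The weight of [f + s D] when [f] is written as a combination of [f + s D] and [f - s' D]. *)
pose u := s' / (s + s').
have us : u * (s + s') = s' by rewrite /u divfK //; lra.
have u01 : 0 < u < 1 by rewrite divr_gt0 ?addr_gt0 // ltr_pdivrMr ?addr_gt0 //; lra.
have fab x : f x = u * (f x + s * D x) + (1 - u) * (f x - s' * D x).
  transitivity (f x + (u * (s + s') - s') * D x); last by ring.
  by rewrite us; ring.
have Dg : D g != 0.
  apply/eqP => Dg; have := fext _ _ u ma mb; rewrite Dg !mulr0 subr0 addr0.
  move=> /(_ erefl erefl u01 fab) /(congr1 (fun h => h x0)) /= h.
  have /eqP : s * D x0 = 0 by lra.
  by rewrite mulf_eq0 (negPf Dx0) gt_eqF.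
apply/funext => x1; apply/eqP; apply: contraT => cx1.
(* Chosen so that [w], which is [c - d] corrected by a multiple of [D], vanishes at [g] and hence
   points along the hyperplane section. *)
pose k := - (c g - d g) / D g / (s + s').
have kE : (c g - d g) + k * (s + s') * D g = 0.
  by rewrite /k; field; rewrite Dg gt_eqF // addr_gt0.
pose w x := (c x - d x) + k * (s + s') * D x.
have [e e0 mw] : exists2 e : R, 0 < e & forall r, `|r| <= e ->
    minorants p (fun x => f x + r * w x).
  (* These three numbers are the barycentric coordinates of [f] in the triangle [c], [d],
     [f - s' D]. Passing to [f + r w] changes each of them by at most [|r| (1 + |k|)]. *)
  pose m := Num.min (u * v) (Num.min (u * (1 - v)) (1 - u)).
  have m0 : 0 < m by rewrite !lt_min; apply/and3P; split; nra.
  have [m1 m2 m3] : [/\ m <= u * v, m <= u * (1 - v) & m <= 1 - u].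
    by split; rewrite /m !ge_min lexx ?orbT.
  have k0 := normr_ge0 k.
  exists (m / (1 + `|k|)); first by rewrite divr_gt0 //; lra.
  move=> r; rewrite ler_pdivlMr; last lra.
  rewrite mulrDr mulr1 -normrM => rm.
  have [mcl cp] := mc; have [mdl dp] := md; have [mbl bp] := mb.
  split=> [|x].
    have fl : real_linear f.
      have -> : f = fun x => (f x + s * D x) + (- s) * D x.
        by apply/funext => x; ring.
      by apply: real_linear_axpy => //; case: ma.
    have -> : (fun x => f x + r * w x) =
        (fun x => (f x + (r * (k * (s + s'))) * D x) + r * (c x + (-1) * d x)).
      by apply/funext => x; rewrite /w; ring.
    by apply: real_linear_axpy => //; exact: real_linear_axpy.
  have -> : f x + r * w x = (u * v + r + (r * k) * v) * c x
     + (u * (1 - v) - r + (r * k) * (1 - v)) * d x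
     + (1 - u - r * k) * (f x - s' * D x).
    rewrite {1}fab aE /w.
    have -> : k * (s + s') * D x = k * ((f x + s * D x) - (f x - s' * D x)) by ring.
    rewrite aE; ring.
  have [r1 r2] : - `|r| <= r /\ r <= `|r|.
    by apply/andP; rewrite -ler_norml.
  have [q1 q2] : - `|r * k| <= r * k /\ r * k <= `|r * k|.
    by apply/andP; rewrite -ler_norml.
  have r3 := normr_ge0 r; have q3 := normr_ge0 (r * k).
  have A1 : 0 <= u * v + r + (r * k) * v by nra.
  have A2 : 0 <= u * (1 - v) - r + (r * k) * (1 - v) by nra.
  have A3 : 0 <= 1 - u - r * k by nra.
  have := ler_wpM2l A1 (cp x); have := ler_wpM2l A2 (dp x).
  by have := ler_wpM2l A3 (bp x); lra.
have wg : w g = 0 by rewrite /w kE.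
have wN x : w x = 0.
  have me : minorants p (fun x => f x + e * w x) by apply: mw; rewrite gtr0_norm.
  have mNe : minorants p (fun x => f x + (- e) * w x).
    by apply: mw; rewrite normrN gtr0_norm.
  have := fext _ _ 2^-1 me mNe; rewrite wg !mulr0 addr0.
  move=> /(_ erefl erefl ltac:(lra)) h.
  have {h} /(congr1 (fun h => h x)) /= h : (fun x => f x + e * w x) = f.
    by apply: h => y; field.
  have /eqP : e * w x = 0 by lra.
  by rewrite mulf_eq0 gt_eqF // => /eqP.
(* As [w] vanishes, [c - d = - l D], so [c] and [d] lie on the line through [f] along [D]. If [l]
   were nonzero, one of them would lie beyond the end [s]. *)
pose l := k * (s + s').
have cE x : c x = f x + (s - (1 - v) * l) * D x.
  have := wN x; rewrite /w -/l => wx; have := aE x.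
  have -> : d x = c x + l * D x by lra.
  by move=> h; have := h; lra.
have dE x : d x = f x + (s + v * l) * D x.
  by have := wN x; rewrite /w -/l cE => wx; lra.
have l0 : l != 0.
  by apply: contraNneq cx1 => l0; rewrite cE l0; apply/eqP; ring.
have [cf df] : c = (fun x => f x + (s - (1 - v) * l) * D x) /\
               d = (fun x => f x + (s + v * l) * D x).
  by split; apply/funext.
have [l_lt0|l_gt0|l_eq0] := ltgtP l 0.
- have := smax (s - (1 - v) * l); rewrite -cf => /(_ _ mc); nra.
- have := smax (s + v * l); rewrite -df => /(_ _ md); nra.
- by move: l0; rewrite l_eq0 eqxx.
Qed.

Lemma line_cone p f (g : V) : minorants p f ->
  constraint_cone iota p (fun x a => exists s, x = iota s *: g /\ a = s * f g).
Proof.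
move=> [[fD fZ] fp]; split.
- by exists 0; rewrite rmorph0 scale0r mul0r.
- move=> _ _ _ _ [s [-> ->]] [t [-> ->]]; exists (s + t).
  by rewrite rmorphD scalerDl mulrDl.
- by move=> r _ _ _ [s [-> ->]]; exists (r * s); rewrite scalerA rmorphM mulrA.
- by move=> _ _ [s [-> ->]]; rewrite -fZ.
Qed.

(** On a full line [s] takes both signs; [s = 1] and [s = -1] give the two inequalities in
    [f' g = f g]. This is a hyperplane section. *)
Lemma slice_minorants p f (g : V) f' : sublinear iota p -> minorants p f ->
  minorants (constrain p (fun x a => exists s, x = iota s *: g /\ a = s * f g)) f'
  <-> minorants p f' /\ f' g = f g.
Proof.
move=> sp mf; rewrite (constrain_minorants sp (line_cone g mf)).
split=> -[mf' Mf']; split=> //; have [[_ fZ] _] := mf'.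
  have h1 : f g <= f' g by apply: Mf'; exists 1; rewrite rmorph1 scale1r mul1r.
  have : -1 * f g <= f' (iota (-1) *: g) by apply: Mf'; exists (-1).
  by rewrite fZ; lra.
by move=> _ _ [s [-> ->]]; rewrite fZ Mf'.
Qed.

(** If [f] is not itself extreme, it is interior to a segment of minorants. Prolonged both ways as
    far as possible, this segment has extreme ends by [line_end_extreme]. *)
Lemma slice_extreme_hull p f0 (g : V) f : sublinear iota p -> minorants p f0 ->
  extreme_minorants
    (constrain p (fun x a => exists s, x = iota s *: g /\ a = s * f0 g)) f ->
  hull (extreme_minorants p) f.
Proof.
move=> sp mf0 [/(slice_minorants _ _ sp mf0)[mf fg] fext].
have {}fext f1 f2 (t : R) : minorants p f1 -> minorants p f2 -> f1 g = f g ->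
    f2 g = f g -> 0 < t < 1 -> (forall x, f x = t * f1 x + (1 - t) * f2 x) ->
    f1 = f.
  move=> m1 m2 g1 g2 t01 fE; apply: fext t01 fE;
    by apply/(slice_minorants _ _ sp mf0); split=> //; rewrite ?g1 ?g2.
have [fe|fNe] := pselect (extreme_minorants p f); first exact: hull_gen.
have [f1 [f2 [t [m1 m2 t01 fE f1f]]]] : exists f1 f2 (t : R),
    [/\ minorants p f1, minorants p f2, 0 < t < 1,
      forall x, f x = t * f1 x + (1 - t) * f2 x & f1 <> f].
  apply: contrapT => nex; apply: fNe; split=> // f1 f2 t m1 m2 t01 fE.
  by apply: contrapT => f1f; apply: nex; exists f1, f2, t.
pose D x := f2 x + (-1) * f1 x.
have Dl : real_linear D by apply: real_linear_axpy; [case: m2|case: m1].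
have Dl' : real_linear (fun x => 0 + (-1) * D x).
  by apply: real_linear_axpy => //; split=> *; ring.
have Dn0 : exists x, D x != 0.
  apply: contrapT => D0; apply: f1f; apply/funext => x; rewrite fE.
  have /eqP : D x == 0 by apply: contrapT => /negP ?; apply: D0; exists x.
  by rewrite /D => Dx; have -> : f2 x = f1 x; [lra|ring].
have [s [s0 ms smax]] := minorants_line_end mf Dl Dn0.
have Dn0' : exists x, 0 + (-1) * D x != 0.
  by case: Dn0 => x Dx; exists x; rewrite add0r mulN1r oppr_eq0.
have [s' [s'0 ms' s'max]] := minorants_line_end mf Dl' Dn0'.
(* From [f = t f1 + (1 - t) f2] follow [f2 = f + t D] and [f1 = f - (1 - t) D], so neither end
   coincides with [f]. *)
have ts : t <= s.
  apply: smax; first lra.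
  suff <- : f2 = (fun x => f x + t * D x) by [].
  by apply/funext => x; rewrite /D fE; ring.
have ts' : 1 - t <= s'.
  apply: s'max; first lra.
  suff <- : f1 = (fun x => f x + (1 - t) * (0 + -1 * D x)) by [].
  by apply/funext => x; rewrite /D fE; ring.
have sp0 : 0 < s by lra.
have s'p0 : 0 < s' by lra.
have ea : extreme_minorants p (fun x => f x + s * D x).
  apply: (line_end_extreme (g := g) (s' := s')) => //.
  by move: ms'; congr (minorants p _); apply/funext => x; ring.
have eb : extreme_minorants p (fun x => f x + s' * (0 + -1 * D x)).
  apply: (line_end_extreme (g := g) (s' := s)) => //.
  by move: ms; congr (minorants p _); apply/funext => x; ring.
have -> : f = (fun x => s' / (s + s') * (f x + s * D x) +
     (1 - s' / (s + s')) * (f x + s' * (0 + -1 * D x))).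
  by apply/funext => x; field; lra.
apply: hull_conv; [exact: hull_gen|exact: hull_gen|].
by rewrite divr_gt0 ?addr_gt0 // ltr_pdivrMr ?addr_gt0 //; lra.
Qed.

(** Cut successively by the hyperplanes where the value at [g] is [f g], and take an extreme
    minorant of the last section. Undoing one cut at a time, [slice_extreme_hull] keeps it in a hull
    of extreme minorants. *)
Lemma minorant_hull_seq p f (gs : seq V) : sublinear iota p -> minorants p f ->
  exists2 e, hull (extreme_minorants p) e & forall g, g \in gs -> e g = f g.
Proof.
elim: gs p => [|g gs IH] p sp mf.
  by have [e ee] := extreme_minorant_exists sp; exists e => //; exact: hull_gen.
have [|e he eE] := IH _ (constrain_sublinear sp (line_cone g mf)).
  by apply/slice_minorants.
exists e; first by move: e he {eE}; apply: hull_trans => e; exact: slice_extreme_hull.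
move=> h; rewrite inE => /predU1P[->|/eE //].
by apply: hull_const he => e' [/slice_minorants[]].
Qed.

Lemma minorant_hull p f (I : finType) (u : I -> V) :
  sublinear iota p -> minorants p f ->
  hull [set e \o u | e in extreme_minorants p] (f \o u).
Proof.
move=> sp mf; have [e he eE] := minorant_hull_seq (codom u) sp mf.
have -> : f \o u = e \o u by apply/funext => i /=; rewrite eE ?codom_f.
by apply: hull_comp he => e' ee'; apply: hull_gen; exists e'.
Qed.

End Dubins.

(** * Real and complex scalars *)

(* The real part [re], and numbers [im_unit], [im_dual] with
   [z = re z + re (im_dual * z) * im_unit] ([0] and [0] for the reals, ['i] and
   [- 'i] for the complex numbers), are all that is needed of the scalars. *)
Record scalars (R : realType) (K : numFieldType) := Scalars {
  ofR : {rmorphism R -> K};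
  re : K -> R;
  im_unit : K;
  im_dual : K;
  reD : forall a b, re (a + b) = re a + re b;
  reZ : forall r z, re (ofR r * z) = r * re z;
  ler_ofR : forall r s, (ofR r <= ofR s) = (r <= s);
  ge0_ofR : forall z, 0 <= z -> ofR (re z) = z;
  re_le_norm : forall z, ofR (re z) <= `|z|;
  re_norm1 : forall z, re z = 1 -> `|z| <= 1 -> z = 1;
  re_decomp : forall z, z = ofR (re z) + ofR (re (im_dual * z)) * im_unit;
  real_linear_extend : forall (V : lmodType K) (g : V -> R),
    real_linear ofR g ->
    exists f : {linear V -> K^o}, forall x, re (f x) = g x }.

Lemma real_scalars (R : realType) : scalars R R.
Proof.
apply: (@Scalars R R idfun id 0 0) => //=.
- by move=> z; exact: ler_norm.
- by move=> z; rewrite mulr0 addr0.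
- move=> V g [gD gZ].
  have gl : linear (g : V -> R^o) by move=> a x y; rewrite gD gZ.
  pose gL := GRing.isLinear.Build _ _ _ _ (g : V -> R^o) gl.
  by exists (HB.pack_for {linear V -> R^o} (g : V -> R^o) gL).
Qed.

Lemma complex_scalars (R : realType) : scalars R (R[i])%C.
Proof.
refine (@Scalars R (R[i])%C (real_complex R : {rmorphism R -> (R[i])%C})
  (@complex.Re R) 'i%C (- 'i%C) _ _ _ _ _ _ _ _).
- by move=> [a1 a2] [b1 b2].
- by move=> r [a b] /=; rewrite mul0r subr0.
- by move=> r s; rewrite lecE /= eqxx.
- by move=> [a b]; rewrite lecE /= => /andP[/eqP -> _].
- move=> [a b]; rewrite normc_def lecE /= eqxx /=.
  rewrite (le_trans (ler_norm _)) // -sqrtr_sqr ler_sqrt ?addr_ge0 ?sqr_ge0 //.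
  by rewrite lerDl sqr_ge0.
- move=> [a b] /= ->; rewrite normc_def lecE /= eqxx /=.
  rewrite -[X in _ <= X]sqrtr1 ler_sqrt //.
  move=> h; have /eqP : b ^+ 2 = 0 by have := sqr_ge0 b; lra.
  by rewrite sqrf_eq0 => /eqP ->.
- by move=> [a b]; apply/eqP; rewrite eq_complex /=; apply/andP; split;
    apply/eqP; ring.
(* The complex linear functional with real part [g] is [g x - i g (i x)]. *)
- move=> V g [gD gZ]; pose f (x : V) := (g x +i* - g ('i%C *: x))%C.
  have fl : linear (f : V -> R[i]%C^o).
    have aE (a : R[i]%C) x : a *: x =
        (complex.Re a)%:C%C *: x + (complex.Im a)%:C%C *: ('i%C *: x).
      rewrite scalerA -scalerDl; congr (_ *: _); case: a => a b /=.
      by apply/eqP; rewrite eq_complex /=; apply/andP; split; apply/eqP; ring.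
    have ii (x : V) : 'i%C *: ('i%C *: x) = (-1)%:C%C *: x.
      rewrite scalerA; congr (_ *: _).
      by apply/eqP; rewrite eq_complex /=; apply/andP; split; apply/eqP; ring.
    move=> a x y; rewrite /f scalerDr !gD.
    have -> : g (a *: x) = complex.Re a * g x + complex.Im a * g ('i%C *: x).
      by rewrite aE gD !gZ.
    have -> : g ('i%C *: (a *: x)) =
        complex.Re a * g ('i%C *: x) - complex.Im a * g x.
      rewrite scalerA mulrC -scalerA aE gD !gZ ii gZ; ring.
    by case: a => a b; apply/eqP; rewrite eq_complex /=; apply/andP; split;
      apply/eqP; ring.
  pose fL := GRing.isLinear.Build _ _ _ _ (f : V -> R[i]%C^o) fl.
  by exists (HB.pack_for {linear V -> R[i]%C^o} (f : V -> R[i]%C^o) fL).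
Qed.

Lemma real_or_complex_scalars (R : realType) (K : numFieldType) :
  real_or_complex R K -> inhabited (scalars R K).
Proof. by case; constructor; [exact: real_scalars|exact: complex_scalars]. Qed.

Section ScalarTheory.
Context {R : realType} {K : numFieldType} (S : scalars R K).

Lemma re0 : re S 0 = 0.
Proof. by have := reD S 0 0; rewrite addr0; lra. Qed.

Lemma reN z : re S (- z) = - re S z.
Proof. by have := reD S z (- z); rewrite subrr re0; lra. Qed.

Lemma re_ofR r : re S (ofR S r) = r.
Proof.
have re1 : re S 1 = 1.
  by apply: (fmorph_inj (ofR S)); rewrite ge0_ofR ?ler01 // rmorph1.
by rewrite -[ofR S r]mulr1 reZ re1 mulr1.
Qed.

End ScalarTheory.

(** * Operator norms and dual balls *)

Section OperatorNorm.
Context {R : realType} {K : numFieldType} (S : scalars R K).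
Implicit Types X Y : normedModType K.

Local Notation re := (re S).
Local Notation ofR := (ofR S).

Lemma re_mono a b : a <= b -> re a <= re b.
Proof.
rewrite -subr_ge0 => /[dup] ab /(ge0_ofR S) abE.
rewrite -subr_ge0 -reN -reD -(ler_ofR S) rmorph0 abE //.
Qed.

Lemma re_norm_le z : re z <= re `|z|.
Proof. by rewrite -[X in X <= _](re_ofR S); apply: re_mono; exact: re_le_norm. Qed.

Lemma ofR_norm X (x : X) : ofR (re `|x|) = `|x|.
Proof. by rewrite ge0_ofR. Qed.

Lemma re_eq0 z : re z = 0 -> re (im_dual S * z) = 0 -> z = 0.
Proof.
by move=> z0 z1; rewrite (re_decomp S z) z0 z1 rmorph0 mul0r addr0.
Qed.

Lemma bounded_opDE X Y (T U : bounded_op X Y) x : (T + U) x = T x + U x.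
Proof. by []. Qed.

Lemma bounded_opZE X Y a (T : bounded_op X Y) x : (a *: T) x = a *: T x.
Proof. by []. Qed.

Lemma bounded_op_ext X Y (T U : bounded_op X Y) : (forall x, T x = U x) -> T = U.
Proof. by move=> TU; apply: val_inj; apply/funext. Qed.

Lemma bounded_opZ X Y (T : bounded_op X Y) a x : T (a *: x) = a *: T x.
Proof. exact: linearZ. Qed.

Lemma bounded_opD X Y (T : bounded_op X Y) x y : T (x + y) = T x + T y.
Proof. exact: linearD. Qed.

Lemma bounded_op0 X Y (T : bounded_op X Y) : T 0 = 0.
Proof. exact: linear0. Qed.

Lemma bounded_op_bound X Y (T : bounded_op X Y) :
  exists2 M : K, 0 <= M & forall x, `|T x| <= M * `|x|.
Proof.
have /asboolP[_ [M TM]] := bounded_opP T.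
exists `|M| => // x; apply: le_trans (TM x) _.
by rewrite -[`|x| in leRHS]normr_id -normrM ger0_norm // (le_trans _ (TM x)).
Qed.

(** [supremum] returns a default when there is no least upper bound. Here one exists: the norms are
    nonnegative, hence come from [R], where their supremum is formed. *)
Lemma opnorm_supremum X Y (T : bounded_op X Y) :
  supremums [set `|T x| | x in unit_ball X] (opnorm T).
Proof.
set E := [set _ | _ in _].
have E0 : E 0 by exists 0; rewrite /unit_ball /= ?bounded_op0 ?normr0 ?ler01.
have Ege0 e : E e -> 0 <= e by case=> x _ <-.
have [M EM] : exists M, ubound E M.
  have [M M0 TM] := bounded_op_bound T.
  exists M => _ [x x1 <-]; apply: le_trans (TM x) _.
  by rewrite -[leRHS]mulr1 ler_wpM2l.
have Mge0 M' : ubound E M' -> ofR (re M') = M'.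
  by move=> EM'; rewrite ge0_ofR // EM'.
pose E' := [set r | E (ofR r)].
have E'0 : E' 0 by rewrite /E' /= rmorph0.
have ubE' M' : ubound E M' -> ubound E' (re M').
  by move=> EM' r Er; rewrite -(ler_ofR S) Mge0 // EM'.
have : supremums E (ofR (sup E')).
  split=> [e Ee|M' EM'].
    have eE := ge0_ofR S (Ege0 _ Ee).
    rewrite -eE ler_ofR; apply: ub_le_sup; first by exists (re M); exact: ubE'.
    by rewrite /E' /= eE.
  rewrite -(Mge0 _ EM') ler_ofR; apply: ge_sup; first by exists 0.
  exact: ubE'.
rewrite /opnorm /supremum -/E ifF; last first.
  by apply/negP => /eqP E00; move: E0; rewrite E00.
by move=> sE; case: xgetP => [//|/(_ _ sE)].
Qed.

Lemma le_opnorm X Y (T : bounded_op X Y) x : `|x| <= 1 -> `|T x| <= opnorm T.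
Proof. by move=> x1; have [+ _] := opnorm_supremum T; apply; exists x. Qed.

Lemma opnorm_le X Y (T : bounded_op X Y) M :
  (forall x, `|x| <= 1 -> `|T x| <= M) -> opnorm T <= M.
Proof.
move=> TM; have [_ +] := opnorm_supremum T; apply => _ [x x1 <-]; exact: TM.
Qed.

Lemma opnorm_ge0 X Y (T : bounded_op X Y) : 0 <= opnorm T.
Proof. by rewrite (le_trans _ (@le_opnorm _ _ T 0 _)) ?normr0 ?ler01. Qed.

Lemma ofR_opnorm X Y (T : bounded_op X Y) : ofR (re (opnorm T)) = opnorm T.
Proof. by rewrite ge0_ofR // opnorm_ge0. Qed.

Lemma norm_le_opnorm X Y (T : bounded_op X Y) x : `|T x| <= opnorm T * `|x|.
Proof.
have [->|x0] := eqVneq x 0; first by rewrite bounded_op0 !normr0 mulr0.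
have nx0 : 0 < `|x| by rewrite normr_gt0.
rewrite -ler_pdivrMr //.
have -> : `|T x| / `|x| = `|T (`|x|^-1 *: x)|.
  by rewrite bounded_opZ normrZ normfV normr_id mulrC.
by apply: le_opnorm; rewrite normrZ normfV normr_id mulVf // gt_eqF.
Qed.

Lemma opnormZ_le X Y a (T : bounded_op X Y) :
  opnorm (a *: T) <= `|a| * opnorm T.
Proof.
apply: opnorm_le => x x1; rewrite bounded_opZE normrZ ler_wpM2l //.
exact: le_opnorm.
Qed.

Lemma norm_sublinear X : sublinear ofR (fun x : X => re `|x|).
Proof.
apply: sublinearW => [x y|r x r0].
  by rewrite -reD; apply: re_mono; exact: ler_normD.
by rewrite normrZ ger0_norm -?reZ // -(rmorph0 ofR) ler_ofR ltW.
Qed.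

Lemma opnorm_sublinear X Y :
  sublinear ofR (fun T : bounded_op X Y => re (opnorm T)).
Proof.
apply: sublinearW => [T U|r T r0].
  rewrite -reD; apply: re_mono; apply: opnorm_le => x x1.
  by rewrite (le_trans (ler_normD _ _)) // lerD // le_opnorm.
rewrite -reZ; apply: re_mono; apply: le_trans (opnormZ_le _ _) _.
by rewrite ger0_norm // -(rmorph0 ofR) ler_ofR ltW.
Qed.

(** Multiplying [x] by the phase [|f x| / f x] turns the value of [f] into [|f x|] without
    increasing [N]. *)
Lemma norm_le_of_re (V : lmodType K) (f : {linear V -> K^o}) (N : V -> R) x :
  (forall a x, `|a| = 1 -> N (a *: x) <= N x) ->
  (forall x, re (f x) <= N x) -> `|f x| <= ofR (N x).
Proof.
move=> NZ fN; rewrite -ofR_norm ler_ofR.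
have [fx0|fx0] := eqVneq (f x) 0.
  by have := fN x; rewrite fx0 normr0.
rewrite (le_trans _ (NZ (`|f x| / f x) x _)) //; last first.
  by rewrite normrM normr_id normfV divff // normr_eq0.
rewrite (le_trans _ (fN _)) // linearZ /=.
by rewrite /GRing.scale /= divfK.
Qed.

Lemma dual_ball_minorant Y (y : dual Y) : opnorm y <= 1 ->
  minorants ofR (fun v : Y => re `|v|) (fun v => re (y v)).
Proof.
move=> y1; split; first split=> [u v|r v].
- by rewrite bounded_opD reD.
- by rewrite bounded_opZ reZ.
- move=> v; apply: le_trans (re_norm_le _) _; apply: re_mono.
  apply: le_trans (norm_le_opnorm y v) _.
  by rewrite -[leRHS]mul1r ler_wpM2r.
Qed.

(** The [K]-linear functional with real part [g] is bounded by rotation. With [dual_ball_minorant],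
    this identifies the dual ball with the minorants of the norm. *)
Lemma minorant_dual_ball Y g : minorants ofR (fun v : Y => re `|v|) g ->
  exists2 y : dual Y, opnorm y <= 1 & forall v, re (y v) = g v.
Proof.
move=> [gl gN]; have [f fg] := real_linear_extend gl.
have fb v : `|f v| <= `|v|.
  rewrite -[leRHS]ofR_norm.
  apply: (norm_le_of_re (N := fun v : Y => re `|v|)) => [a w a1|w].
    by rewrite normrZ a1 mul1r.
  by rewrite fg.
have fbl : (f : Y -> K^o) \in @is_bounded_linear K Y K^o.
  apply/asboolP; split; first exact: linearP.
  by exists 1 => v; rewrite mul1r.
exists (BoundedOp fbl) => //; apply: opnorm_le => v v1.
exact: le_trans (fb v) v1.
Qed.

Lemma norming_functional X (x : X) :
  exists2 f : dual X, opnorm f <= 1 & re (f x) = re `|x|.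
Proof.
have [g mg gx] := supporting_minorant x (norm_sublinear X).
by have [f f1 fg] := minorant_dual_ball mg; exists f; rewrite ?fg.
Qed.

Lemma dual_separates X (a b : X) :
  (forall f : dual X, re (f a) = re (f b)) -> a = b.
Proof.
move=> fab; have [f _] := norming_functional (a - b).
rewrite linearB /= reD reN fab subrr.
move=> nab; apply/eqP; rewrite -subr_eq0 -normr_eq0 -ofR_norm -nab.
by rewrite rmorph0.
Qed.

Lemma dual_re_ext X (f g : dual X) : (forall x, re (f x) = re (g x)) -> f = g.
Proof.
move=> fg; apply: bounded_op_ext => x; apply/eqP; rewrite -subr_eq0; apply/eqP.
apply: re_eq0; first by rewrite reD reN fg subrr.
rewrite mulrBr reD reN.
have := fg (im_dual S *: x); rewrite !bounded_opZ => ->.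
by rewrite subrr.
Qed.

Lemma ball_minorant X (x : X) : `|x| <= 1 ->
  minorants ofR (fun f : dual X => re (opnorm f)) (fun f => re (f x)).
Proof.
move=> x1; split; first split=> [u v|r v].
- by rewrite bounded_opDE reD.
- by rewrite bounded_opZE reZ.
- move=> f; apply: le_trans (re_norm_le _) _; apply: re_mono.
  exact: le_opnorm.
Qed.

(** Reflexivity represents the [K]-linear extension of [g] by a vector, and a norming functional of
    that vector shows that it lies in the ball. *)
Lemma minorant_ball X g : reflexive_space X ->
  minorants ofR (fun f : dual X => re (opnorm f)) g ->
  exists2 x : X, `|x| <= 1 & forall f : dual X, re (f x) = g f.
Proof.
move=> reflX [gl gN]; have [phi phig] := real_linear_extend gl.
have [|x phix] := reflX phi.
  exists 1 => f; rewrite mul1r -[leRHS]ofR_opnorm.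
  apply: (norm_le_of_re (N := fun f : dual X => re (opnorm f))) => [a w a1|w].
    by apply: re_mono; apply: le_trans (opnormZ_le _ _) _; rewrite a1 mul1r.
  by rewrite phig.
exists x => [|f]; last by rewrite -phix.
have [f f1 fx] := norming_functional x.
rewrite -ofR_norm -fx -phix phig -(rmorph1 ofR) ler_ofR.
by apply: le_trans (gN f) _; rewrite -[leRHS](re_ofR S) rmorph1; exact: re_mono.
Qed.

End OperatorNorm.

(** * Means on bounded functions *)

Section BoundedFunctions.
Context (R : realType) (Z : Type).

Definition is_bounded_fun : {pred Z -> R^o} :=
  fun f => `[< exists M : R, forall z, `|f z| <= M >].

Record bounded_fun := BoundedFun {
  bounded_fun_val :> Z -> R^o ;
  bounded_funP : bounded_fun_val \in is_bounded_fun }.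

HB.instance Definition _ := [isSub for bounded_fun_val].
HB.instance Definition _ := [Choice of bounded_fun by <:].

Fact is_bounded_fun_submod : submod_closed is_bounded_fun.
Proof.
split=> [|a f g /asboolP[M fM] /asboolP[N gN]]; apply/asboolP.
  by exists 0 => z; rewrite normr0.
exists (`|a| * M + N) => z; apply: le_trans (ler_normD _ _) _.
by rewrite lerD // normrM ler_wpM2l.
Qed.

HB.instance Definition _ :=
  GRing.isSubmodClosed.Build R (Z -> R^o) is_bounded_fun is_bounded_fun_submod.
HB.instance Definition _ := [SubChoice_isSubLmodule of bounded_fun by <:].

End BoundedFunctions.

Section Means.
Context {R : realType} {Z : Type} (z0 : Z).
Implicit Types (f g h : bounded_fun R Z) (G : bounded_fun R Z -> R).

Lemma bounded_fun_ext f g : (forall z, f z = g z) -> f = g.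
Proof. by move=> fg; apply: val_inj; apply/funext. Qed.

Lemma bounded_fun_bound f : exists2 M : R, 0 < M & forall z, `|f z| <= M.
Proof.
have /asboolP[M fM] := bounded_funP f; exists (`|M| + 1).
  by have := normr_ge0 M; lra.
by move=> z; have := fM z; have := ler_norm M; lra.
Qed.

Fact bounded_fun_cst_subproof (c : R) : (fun=> c) \in @is_bounded_fun R Z.
Proof. by apply/asboolP; exists `|c|. Qed.
Definition bounded_cst (c : R) := BoundedFun (bounded_fun_cst_subproof c).

Fact bounded_fun_mul_subproof f g :
  (fun z => (f z : R) * g z) \in @is_bounded_fun R Z.
Proof.
have [M _ fM] := bounded_fun_bound f; have [N _ gN] := bounded_fun_bound g.
by apply/asboolP; exists (M * N) => z; rewrite normrM ler_pM.
Qed.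
Definition bounded_mul f g := BoundedFun (bounded_fun_mul_subproof f g).

Definition bsup f : R := sup [set f z | z in [set: Z]].

Lemma le_bsup f z : f z <= bsup f.
Proof.
apply: ub_le_sup; last by exists z.
have [M _ fM] := bounded_fun_bound f.
by exists M => _ [w _ <-]; exact: le_trans (ler_norm _) (fM w).
Qed.

Lemma bsup_le f (c : R) : (forall z, f z <= c) -> bsup f <= c.
Proof. by move=> fc; apply: ge_sup => [|_ [z _ <-]]; [exists (f z0), z0|]. Qed.

Lemma bsup_sublinear : sublinear (idfun : {rmorphism R -> R}) bsup.
Proof.
apply: sublinearW => [f g|r f r0]; apply: bsup_le => z.
  by apply: lerD; exact: le_bsup.
by rewrite /= ler_pM2l //; exact: le_bsup.
Qed.

(** These are the finitely additive probabilities on [Z]: lying below the supremum forces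
    monotonicity and the right values on constants. *)
Definition mean : set (bounded_fun R Z -> R) :=
  minorants (idfun : {rmorphism R -> R}) bsup.

Lemma mean_mono G f g : mean G -> (forall z, f z <= g z) -> G f <= G g.
Proof.
move=> [Gl Gs] fg; have [GD _] := Gl.
suff : G (f - g) <= 0 by rewrite GD (real_linearN _ Gl); lra.
by apply: le_trans (Gs _) _; apply: bsup_le => z; rewrite /= subr_le0.
Qed.

Lemma mean_cst G c : mean G -> G (bounded_cst c) = c.
Proof.
move=> mG; have [Gl Gs] := mG; apply/eqP; rewrite eq_le; apply/andP; split.
  by apply: le_trans (Gs _) _; exact: bsup_le.
rewrite -lerN2 -(real_linearN _ Gl); apply: le_trans (Gs _) _.
exact: bsup_le.
Qed.

(* If [w] is centred with [|w| <= 1], then [G] is the midpoint of the means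
   [h |-> G (h + w h)] and [h |-> G (h - w h)]. *)
Lemma extreme_mean_centred G (w h : bounded_fun R Z) :
  extreme_minorants (idfun : {rmorphism R -> R}) bsup G ->
  (forall z, `|w z| <= 1) -> G w = 0 -> G (bounded_mul w h) = 0.
Proof.
move=> [mG Gext] w1 Gw; have [Gl Gs] := mG; have [GD GZ] := Gl.
have mE (r : R) : `|r| = 1 -> mean (fun h => G h + r * G (bounded_mul w h)).
  move=> r1; split=> [|k].
    apply: real_linear_axpy => //; split=> [k l|a k].
      rewrite -GD; congr G; apply: bounded_fun_ext => z /=.
      by rewrite -mulrDr.
    rewrite -GZ; congr G; apply: bounded_fun_ext => z /=.
    by rewrite /GRing.scale /= mulrCA.
  rewrite -GZ -GD -[leRHS](mean_cst _ mG).
  (* As [G w = 0], the constant may be replaced by [(1 + r w) bsup k], which dominates [(1 + r w) k]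
     because [1 + r w >= 0]. *)
  have -> : G (bounded_cst (bsup k)) = G (bounded_cst (bsup k) + (r * bsup k) *: w).
    by rewrite GD GZ Gw mulr0 addr0.
  apply: mean_mono => // z /=.
  have rw : -1 <= r * w z.
    have : `|r * w z| <= 1 by rewrite normrM r1 mul1r.
    by rewrite ler_norml => /andP[].
  have kz := le_bsup k z.
  suff : (k z : R) + r * ((w z : R) * k z) <= bsup k + r * bsup k * (w z : R) by [].
  move: rw kz; set a : R := w z; set b : R := k z; nra.
have [m1 m2] := (mE 1 (normr1 _), mE (-1) (normrN1 _)).
have /(congr1 (fun F => F h)) /= : (fun h => G h + 1 * G (bounded_mul w h)) = G.
  by apply: (Gext _ _ 2^-1 m1 m2) => [|k]; [lra|field].
by lra.
Qed.

Lemma extreme_mean_mul G f h :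
  extreme_minorants (idfun : {rmorphism R -> R}) bsup G ->
  G (bounded_mul f h) = G f * G h.
Proof.
move=> eG; have [mG _] := eG; have [[GD GZ] _] := mG.
have [M M0 fM] := bounded_fun_bound f.
(* With this factor [a f] and its mean [c] are both at most [1/2] in absolute value, so the centred
   function [w] satisfies [|w| <= 1]. *)
pose a := (2 * M)^-1; pose c := a * G f.
have a0 : 0 < a by rewrite invr_gt0; lra.
pose w := a *: f - bounded_cst c.
have Gw : G w = 0.
  by rewrite GD (real_linearN _ (proj1 mG)) mean_cst // GZ subrr.
have afM z : `|a * f z| <= 2^-1.
  rewrite normrM gtr0_norm // /a invfM -mulrA -[leRHS]mulr1 ler_pM2l ?invr_gt0 //.
  by rewrite mulrC ler_pdivrMr // mul1r.
have c2 : `|c| <= 2^-1.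
  rewrite /c -GZ ler_norml; apply/andP; split.
    rewrite -[leLHS](mean_cst _ mG); apply: mean_mono => // z /=.
    by have := afM z; rewrite ler_norml => /andP[].
  rewrite -[leRHS](mean_cst _ mG); apply: mean_mono => // z /=.
  by have := afM z; rewrite ler_norml => /andP[].
have w1 z : `|w z| <= 1.
  rewrite -[w z]/(a * f z - c : R) (le_trans (ler_normB _ _)) //.
  by have := afM z; lra.
have := extreme_mean_centred h eG w1 Gw.
have -> : bounded_mul w h = a *: bounded_mul f h + (- c) *: h.
  apply: bounded_fun_ext => z.
  rewrite -[RHS]/(a * (f z * h z) + - c * h z : R).
  by rewrite -[LHS]/((a * f z - c) * h z : R); ring.
rewrite GD !GZ /c mulNr -mulrA => /eqP; rewrite subr_eq0 => /eqP.
by apply: mulfI; rewrite gt_eqF.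
Qed.

End Means.

(** * Operators into a finite dimensional space *)

Section Composition.
Context {K : numFieldType} {X Y Z : normedModType K}.
Context (U : bounded_op Y Z) (T : bounded_op X Y).

Fact bounded_comp_subproof : (U \o T) \in @is_bounded_linear K X Z.
Proof.
apply/asboolP; split=> [a x y|]; first by rewrite /= !linearP.
have [M M0 UM] := bounded_op_bound U; have [N N0 TN] := bounded_op_bound T.
exists (M * N) => x; rewrite -mulrA.
by apply: le_trans (UM _) _; rewrite ler_wpM2l.
Qed.

Definition bounded_comp := BoundedOp bounded_comp_subproof.

End Composition.

Section Operators.
Context {R : realType} {K : numFieldType} (S : scalars R K).

Local Notation re := (re S).
Local Notation ofR := (ofR S).

(** Expresses the real part of a product through products of real functions, to which the
    multiplicativity of extreme means applies. *)
Lemma re_mul a b : re (a * b) =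
  re a * re b + re (im_dual S * a) * re (im_unit S * b).
Proof.
by rewrite {1}(re_decomp S a) mulrDl reD reZ -mulrA reZ.
Qed.

(* Each step projects the next vector off the span of the previous ones, and a
   norming functional of what is left provides the new coordinate. *)
Lemma seq_coordinates (Y : normedModType K) (s : seq Y) :
  exists r : seq (dual Y * Y),
    forall e, e \in s -> e = \sum_(c <- r) (c.1 e : K) *: c.2.
Proof.
elim: s => [|e s [r rE]]; first by exists [::].
pose Q (z : Y) := z - \sum_(c <- r) (c.1 z : K) *: c.2.
have [Qe|Qe] := eqVneq (Q e) 0.
  exists r => z; rewrite inE => /predU1P[->|/rE //].
  by apply/eqP; rewrite -subr_eq0 -/(Q e) Qe.
have [f _ fQe] := norming_functional S (Q e).
have fQe0 : (f (Q e) : K) != 0.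
  apply: contra_neq Qe => fe; apply/eqP; rewrite -normr_eq0 -(ofR_norm S) -fQe fe.
  by rewrite re0 rmorph0.
(* This is [f (Q z) / f (Q e)], equal to [1] at [e] and to [0] on [s], where [Q] vanishes. *)
pose g : dual Y := (f (Q e) : K)^-1 *: (f - \sum_(c <- r) (f c.2 : K) *: c.1).
have gE z : g z = ((f (Q e))^-1 * f (Q z) : K).
  rewrite /g bounded_opZE; congr (_ * _).
  rewrite bounded_opDE /Q linearB (linear_sum f).
  have -> (u : dual Y) : (- u) z = - u z by [].
  congr (_ - _).
  elim/big_rec2: _ => [//|c a b _ <-].
  rewrite bounded_opDE bounded_opZE linearZ /=; congr (_ + _).
  by rewrite /GRing.scale /= mulrC.
exists ((g, Q e) :: r) => z; rewrite inE big_cons.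
rewrite -[(g, Q e).1 z]/(g z) gE => /predU1P[->|zs].
  by rewrite mulVf // scale1r /Q subrK.
have -> : Q z = 0 by rewrite /Q -rE // subrr.
by rewrite linear0 mulr0 scale0r add0r -rE.
Qed.

Lemma finite_dimensional_coordinates (Y : normedModType K) :
  finite_dimensional [set: Y] ->
  exists r : seq (dual Y * Y), forall z, z = \sum_(c <- r) (c.1 z : K) *: c.2.
Proof.
move=> [n [e eT]]; have [r rE] := seq_coordinates (codom e); exists r => z.
have [c ->] : exists c : 'I_n -> K, z = \sum_i c i *: e i.
  by have : [set: Y] z by []; rewrite eT.
have lin (u : dual Y) : u (\sum_i c i *: e i) = \sum_i (c i : K) * u (e i).
  by rewrite linear_sum; apply: eq_bigr => i _; rewrite linearZ.
under [RHS]eq_bigr do rewrite lin scaler_suml.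
rewrite exchange_big /=; apply: eq_bigr => i _.
rewrite {1}(rE (e i)) ?codom_f // scaler_sumr.
by apply: eq_bigr => k _; rewrite scalerA.
Qed.

Context {X Y : normedModType K}.

Definition ball_pair : Type :=
  {z : X * dual Y | `|z.1| <= 1 /\ opnorm z.2 <= 1}.

Lemma norm_re_le (z : K) (r : K) : `|z| <= r -> `|re z| <= re r.
Proof.
move=> zr; rewrite ler_norml; apply/andP; split.
  rewrite lerNl -reN; apply: le_trans (re_norm_le S _) _; rewrite normrN.
  exact: re_mono.
by apply: le_trans (re_norm_le S _) _; exact: re_mono.
Qed.

Lemma dual_ball_le (y : dual Y) v : opnorm y <= 1 -> `|y v| <= `|v|.
Proof.
move=> y1; apply: le_trans (norm_le_opnorm S y v) _.
by rewrite -[leRHS]mul1r ler_wpM2r.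
Qed.

Fact dual_fun_subproof (f : dual X) :
  (fun z : ball_pair => re (f (sval z).1)) \in @is_bounded_fun R ball_pair.
Proof.
apply/asboolP; exists (re (opnorm f)) => -[[x y] /= [x1 y1]].
by apply: norm_re_le; exact: (le_opnorm S).
Qed.
Definition dual_fun f := BoundedFun (dual_fun_subproof f).

Fact vector_fun_subproof (v : Y) :
  (fun z : ball_pair => re ((sval z).2 v)) \in @is_bounded_fun R ball_pair.
Proof.
apply/asboolP; exists (re `|v|) => -[[x y] /= [x1 y1]].
by apply: norm_re_le; exact: dual_ball_le.
Qed.
Definition vector_fun v := BoundedFun (vector_fun_subproof v).

Lemma pairing_le (A : bounded_op X Y) (x : X) (y : dual Y) :
  `|x| <= 1 -> opnorm y <= 1 -> `|y (A x)| <= opnorm A.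
Proof.
by move=> x1 y1; apply: le_trans (dual_ball_le _ y1) _; exact: (le_opnorm S).
Qed.

Fact op_fun_subproof (A : bounded_op X Y) :
  (fun z : ball_pair => re ((sval z).2 (A (sval z).1)))
    \in @is_bounded_fun R ball_pair.
Proof.
apply/asboolP; exists (re (opnorm A)) => -[[x y] /= [x1 y1]].
by apply: norm_re_le; exact: pairing_le.
Qed.
Definition op_fun A := BoundedFun (op_fun_subproof A).

Lemma ball_pair0 : ball_pair.
Proof.
exists (0, 0) => /=; split; first by rewrite normr0 ler01.
by apply: (opnorm_le S) => v _; rewrite normr0 ler01.
Qed.

Lemma op_funD A B : op_fun (A + B) = op_fun A + op_fun B.
Proof.
apply: bounded_fun_ext => z.
exact: etrans (congr1 re (bounded_opD _ _ _)) (reD S _ _).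
Qed.

Lemma op_funZ (r : R) A : op_fun (ofR r *: A) = r *: op_fun A.
Proof.
apply: bounded_fun_ext => z.
exact: etrans (congr1 re (bounded_opZ _ _ _)) (reZ S _ _).
Qed.

Lemma op_fun_bsup A : bsup (op_fun A) = re (opnorm A).
Proof.
apply/eqP; rewrite eq_le; apply/andP; split.
  apply: (bsup_le ball_pair0) => -[[x y] /= [x1 y1]].
  apply: le_trans (re_norm_le S _) _; apply: re_mono.
  exact: pairing_le.
rewrite -(ler_ofR S) ofR_opnorm; apply: (opnorm_le S) => x x1.
have [y y1 yAx] := norming_functional S (A x).
rewrite -(ofR_norm S) ler_ofR -yAx.
exact: (le_bsup (op_fun A) (exist _ (x, y) (conj x1 y1))).
Qed.

(* An extreme mean is multiplicative, so it commutes with the finite expansion of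
   [y (A x)] in coordinates of [A x]; reflexivity turns its values on [X^*] and on
   [Y] into a pair [(x, y)]. *)
Lemma extreme_mean_point G : reflexive_space X -> finite_dimensional [set: Y] ->
  extreme_minorants (idfun : {rmorphism R -> R}) (@bsup R ball_pair) G ->
  exists (x : X) (y : dual Y), [/\ `|x| <= 1, opnorm y <= 1 &
    forall A, G (op_fun A) = re (y (A x))].
Proof.
move=> reflX fdY eG; have [mG _] := eG; have [Gl Gs] := mG; have [GD GZ] := Gl.
have [|x x1 xE] := @minorant_ball _ _ S X (G \o dual_fun) reflX.
  split=> [|f] /=.
    split=> [f g|r f] /=; [rewrite -GD|rewrite -GZ]; congr G;
      apply: bounded_fun_ext => z.
      exact: reD.
    exact: reZ.
  apply: le_trans (Gs _) _; apply: (bsup_le ball_pair0) => -[[x y] /= [x1 y1]].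
  by apply: le_trans (re_norm_le S _) _; apply: re_mono; exact: (le_opnorm S).
have [|y y1 yE] := @minorant_dual_ball _ _ S Y (G \o vector_fun).
  split=> [|f] /=.
    split=> [f g|r f] /=; [rewrite -GD|rewrite -GZ]; congr G;
      apply: bounded_fun_ext => z.
      exact: etrans (congr1 re (bounded_opD _ _ _)) (reD S _ _).
    exact: etrans (congr1 re (bounded_opZ _ _ _)) (reZ S _ _).
  apply: le_trans (Gs _) _; apply: (bsup_le ball_pair0) => -[[x' y] /= [x'1 y1]].
  by apply: le_trans (re_norm_le S _) _; apply: re_mono; exact: dual_ball_le.
exists x, y; split=> // A.
have [r rE] := finite_dimensional_coordinates fdY.
(* Every product here has one factor depending on [x'] alone and one depending on [y'] alone. *)
have expand (x' : X) (y' : dual Y) : re (y' (A x')) =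
    \sum_(c <- r) (re (bounded_comp c.1 A x') * re (y' c.2) +
       re ((im_dual S *: bounded_comp c.1 A) x') * re (y' (im_unit S *: c.2))).
  rewrite {1}(rE (A x')) linear_sum /=.
  rewrite (big_morph re (reD S) (re0 S)); apply: eq_bigr => c _.
  by rewrite !linearZ /= re_mul.
rewrite expand.
have -> : op_fun A = \sum_(c <- r)
    (bounded_mul (dual_fun (bounded_comp c.1 A)) (vector_fun c.2) +
     bounded_mul (dual_fun (im_dual S *: bounded_comp c.1 A))
                 (vector_fun (im_unit S *: c.2))).
  apply: bounded_fun_ext => z; rewrite /= expand.
  elim/big_rec2: _ => [//|c a b _ ->].
  by [].
rewrite (real_linear_sum _ _ _ Gl); apply: eq_bigr => c _.
by rewrite GD !(extreme_mean_mul ball_pair0) // !xE !yE.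
Qed.

(** Hahn-Banach with the constraints [a <= F (op_fun (a T + A))], which are satisfiable: for
    [a > 0], orthogonality with multiplier [a^-1] bounds [a] by the norm of [a T + A]. They make [F]
    nonnegative on [W], hence zero there since [W] is symmetric. *)
Lemma bj_orthogonal_mean (T : bounded_op X Y) (W : set (bounded_op X Y)) :
  opnorm T = 1 -> linear_subspace W -> bj_orthogonal_to T W ->
  exists F, [/\ mean F, F (op_fun T) = 1 & forall A, W A -> F (op_fun A) = 0].
Proof.
move=> T1 [W0 WP] TW.
have WD A B : W A -> W B -> W (A + B).
  by move=> WA WB; rewrite -[A]scale1r; exact: WP.
have WZ a A : W A -> W (a *: A).
  by move=> WA; rewrite -[_ *: _]addr0; exact: WP.
pose M (h : bounded_fun R ball_pair) (a : R) :=
  exists2 A, W A & h = op_fun (ofR a *: T + A).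
have cM : constraint_cone (idfun : {rmorphism R -> R}) (@bsup R ball_pair) M.
  split.
  - exists 0 => //; apply: bounded_fun_ext => z.
    rewrite rmorph0 scale0r addr0.
    exact: esym (etrans (congr1 re (bounded_op0 (sval z).2)) (re0 S)).
  - move=> _ _ a b [A WA ->] [B WB ->]; exists (A + B); first exact: WD.
    by rewrite -op_funD rmorphD scalerDl addrACA.
  - move=> r _ a r0 [A WA ->]; exists (ofR r *: A); first exact: WZ.
    by rewrite /= -op_funZ scalerDr scalerA rmorphM.
  - move=> _ a [A WA ->]; rewrite op_fun_bsup.
    have [a0|a0] := leP a 0.
      apply: le_trans a0 _; rewrite -(re0 S); apply: re_mono.
      exact: (opnorm_ge0 S).
    have := TW _ WA (ofR a^-1); rewrite T1.
    have aE : T + ofR a^-1 *: A = ofR a^-1 *: (ofR a *: T + A).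
      by rewrite scalerDr scalerA -rmorphM mulVf ?gt_eqF // rmorph1 scale1r.
    rewrite aE => /le_trans /(_ (opnormZ_le S _ _)).
    rewrite ger0_norm; last by rewrite -(rmorph0 ofR) ler_ofR invr_ge0 ltW.
    move=> /(re_mono S); rewrite reZ -(rmorph1 ofR) re_ofR.
    by rewrite -ler_pdivrMl ?invr_gt0 // invrK mulr1.
have [F mF FM] := constrained_minorant (bsup_sublinear ball_pair0) cM.
have [Fl Fs] := mF; exists F; split=> // [|A WA].
  apply/eqP; rewrite eq_le; apply/andP; split.
    apply: le_trans (Fs _) _; rewrite op_fun_bsup T1.
    by rewrite -[leRHS](re_ofR S) rmorph1.
  by apply: FM; exists 0 => //; rewrite rmorph1 scale1r addr0.
have F0 B : W B -> 0 <= F (op_fun B).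
  by move=> WB; apply: FM; exists B => //; rewrite rmorph0 scale0r add0r.
apply/eqP; rewrite eq_le F0 // andbT.
have := F0 (ofR (-1) *: A) (WZ _ _ WA); rewrite op_funZ.
by have [_ FZ] := Fl; rewrite (FZ (-1)); lra.
Qed.

End Operators.

(** * Extreme points of the two balls, and norm-attaining pairs *)

Lemma extreme_points_sub {K : numFieldType} {V : lmodType K} (C D : set V) x :
  D `<=` C -> D x -> extreme_points C x -> extreme_points D x.
Proof.
move=> DC Dx [_ ext]; split=> // a b t /DC Ca /DC Cb; exact: ext.
Qed.

Section ExtremePoints.
Context {R : realType} {K : numFieldType} (S : scalars R K).
Context {X Y : normedModType K}.

Local Notation re := (re S).
Local Notation ofR := (ofR S).

Lemma ltr_ofR r s : (ofR r < ofR s) = (r < s).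
Proof. by rewrite !lt_def ler_ofR (inj_eq (fmorph_inj ofR)). Qed.

Lemma ofR_itv01 (t : K) : 0 < t < 1 -> ofR (re t) = t /\ 0 < re t < 1.
Proof.
case/andP=> t0 t1; have tE := ge0_ofR S (ltW t0); split=> //.
by rewrite -!ltr_ofR tE rmorph0 rmorph1 t0.
Qed.

(** A scalar of [K] strictly between [0] and [1] comes from [R], and exchanging [a] with [b] gives
    the second equality. *)
Lemma extreme_pointsW (V : lmodType K) (C : set V) x : C x ->
  (forall a b (t : R), C a -> C b -> 0 < t < 1 ->
     x = ofR t *: a + ofR (1 - t) *: b -> a = x) -> extreme_points C x.
Proof.
move=> Cx ext; split=> // a b t Ca Cb /ofR_itv01[tE]; move: (re t) tE => r <- t01.
rewrite -[1 - ofR r](_ : ofR (1 - r) = _); last by rewrite rmorphB rmorph1.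
move=> xE; split; first exact: (ext a b r).
apply: (ext b a (1 - r)) => //; first by lra.
by rewrite subKr addrC.
Qed.

(** Taking real parts is affine and injective on functionals, so a proper combination in the ball
    would give one among the minorants. *)
Lemma extreme_minorant_dual_ball g :
  extreme_minorants ofR (fun v : Y => re `|v|) g ->
  exists2 y : dual Y, extreme_points [set y : dual Y | opnorm y <= 1] y
    & forall v, re (y v) = g v.
Proof.
move=> [mg gext]; have [y y1 yE] := minorant_dual_ball mg.
exists y => //; apply: extreme_pointsW => // a b t a1 b1 t01 yab.
apply: (dual_re_ext (S := S)) => v; rewrite yE.
have -> // : g = (fun v => re (a v)).
apply/esym/(gext _ _ t (dual_ball_minorant S a1) (dual_ball_minorant S b1) t01).
by move=> w; rewrite -yE yab bounded_opDE reD !bounded_opZE !reZ.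
Qed.

Lemma extreme_minorant_ball g : reflexive_space X ->
  extreme_minorants ofR (fun f : dual X => re (opnorm f)) g ->
  exists2 x : X, extreme_points (unit_ball X) x
    & forall f : dual X, re (f x) = g f.
Proof.
move=> reflX [mg gext]; have [x x1 xE] := minorant_ball reflX mg.
exists x => //; apply: extreme_pointsW => // a b t a1 b1 t01 xab.
apply: (dual_separates (S := S)) => f; rewrite xE.
have -> // : g = (fun f => re (f a)).
apply/esym/(gext _ _ t (ball_minorant S a1) (ball_minorant S b1) t01).
by move=> w; rewrite -xE xab bounded_opD reD !bounded_opZ !reZ.
Qed.

Lemma dual_ball_hull (I : finType) (v : I -> Y) (y : dual Y) : opnorm y <= 1 ->
  hull [set (fun i => re (y' (v i))) | y' in
          extreme_points [set y : dual Y | opnorm y <= 1]]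
       (fun i => re (y (v i))).
Proof.
move=> /(dual_ball_minorant S) my.
apply: hull_trans (minorant_hull v (norm_sublinear S Y) my) => _ [g eg <-].
have [y' ey' y'E] := extreme_minorant_dual_ball eg.
by apply: hull_gen; exists y' => //; apply/funext => i /=.
Qed.

Lemma ball_hull (I : finType) (f : I -> dual X) (x : X) : reflexive_space X ->
  `|x| <= 1 ->
  hull [set (fun i => re (f i x')) | x' in extreme_points (unit_ball X)]
       (fun i => re (f i x)).
Proof.
move=> reflX /(ball_minorant S) mx.
apply: hull_trans (minorant_hull f (opnorm_sublinear S X K^o) mx) => _ [g eg <-].
have [x' ex' x'E] := extreme_minorant_ball reflX eg.
by apply: hull_gen; exists x' => //; apply/funext => i /=.
Qed.

(* The three applications of Dubins' theorem: to the means on pairs, to the dual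
   ball of [Y], and to the ball of [X]. *)
Lemma bj_orthogonal_hull (T : bounded_op X Y) (W : set (bounded_op X Y))
    (I : finType) (u : I -> bounded_op X Y) :
  reflexive_space X -> finite_dimensional [set: Y] ->
  opnorm T = 1 -> linear_subspace W -> bj_orthogonal_to T W ->
  (forall i, W (u i)) ->
  hull [set phi | exists (x : X) (y : dual Y),
          [/\ extreme_points (unit_ball X) x,
              extreme_points [set y : dual Y | opnorm y <= 1] y &
              phi = fun i : option I => re (y (oapp u T i x))]]
       (fun i => if i is Some _ then 0 else 1).
Proof.
move=> reflX fdY T1 subW TW Wu; set Phi := [set _ | _].
have [F [mF FT FW]] := bj_orthogonal_mean S T1 subW TW.
have := minorant_hull (fun i => op_fun S (oapp u T i))
          (bsup_sublinear (ball_pair0 S)) mF.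
have -> : F \o (fun i => op_fun S (oapp u T i)) =
    (fun i => if i is Some _ then 0 else 1).
  by apply/funext => -[i|] /=; rewrite ?FT ?FW.
apply: hull_trans => _ [G eG <-].
have [x [y [x1 y1 GE]]] := extreme_mean_point S reflX fdY eG.
have -> : G \o (fun i => op_fun S (oapp u T i)) =
    (fun i => re (y (oapp u T i x))) by apply/funext => i; exact: GE.
apply: hull_trans (dual_ball_hull (fun i => oapp u T i x) y1) => _ [y' ey' <-].
(* For fixed [y'], the compositions of [y'] with the operators are elements of the dual of [X]. *)
apply: hull_trans (ball_hull (fun i => bounded_comp y' (oapp u T i)) reflX x1).
by move=> _ [x' ex' <-]; apply: hull_gen; exists x', y'.
Qed.

(** Equality holds throughout [1 = re (y (T x)) <= |y (T x)| <= |T x| <= 1]. *)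
Lemma pairing_attained (T : bounded_op X Y) (x : X) (y : dual Y) :
  opnorm T = 1 -> `|x| <= 1 -> opnorm y <= 1 -> re (y (T x)) = 1 ->
  norm_attainment T x /\ support_functionals (T x) y.
Proof.
move=> T1 x1 y1 re1.
have yTx : y (T x) = 1 :> K.
  by apply: (re_norm1 re1); rewrite -T1; exact: (pairing_le S).
have Tx : `|T x| = 1.
  apply/eqP; rewrite eq_le -{1}T1 (le_opnorm S) //=.
  by rewrite (le_trans _ (dual_ball_le S (T x) y1)) // yTx normr1.
split; split.
- apply/eqP; rewrite /unit_sphere /= eq_le x1 /=.
  by have := norm_le_opnorm S T x; rewrite T1 mul1r Tx.
- by rewrite Tx.
- apply/eqP; rewrite eq_le y1 /=.
  by have := norm_le_opnorm S y (T x); rewrite yTx Tx normr1 mulr1.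
- by rewrite yTx Tx.
Qed.

(** For [A] in [W], the weighted sum of the [y i ((T + mu A) (x i))] is the norm of [T] whatever
    [mu] is, and the norm of [T + mu A] bounds it. *)
Lemma attaining_pairs_bj_orthogonal (T : bounded_op X Y)
    (W : set (bounded_op X Y)) (h : nat) (x : 'I_h -> X) (y : 'I_h -> dual Y)
    (lambda : 'I_h -> K) :
  (forall i, norm_attainment T (x i)) ->
  (forall i, support_functionals (T (x i)) (y i)) ->
  (forall i, 0 < lambda i) -> \sum_i lambda i = 1 ->
  (forall A, W A -> \sum_i lambda i * y i (A (x i)) = 0) ->
  bj_orthogonal_to T W.
Proof.
move=> Tx Ty l0 l1 lW A WA mu.
rewrite -(ger0_norm (opnorm_ge0 S T)).
have -> : opnorm T = \sum_i lambda i * y i ((T + mu *: A) (x i)).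
  transitivity (\sum_i lambda i * y i (T (x i)) +
                mu * \sum_i lambda i * y i (A (x i))).
    rewrite (lW _ WA) [X in _ + X]mulr0 addr0 -[LHS]mul1r -l1 mulr_suml.
    apply: eq_bigr => i _.
    by have [_ ->] := Ty i; have [_ ->] := Tx i.
  rewrite mulr_sumr -big_split; apply: eq_bigr => i _.
  rewrite bounded_opDE bounded_opZE bounded_opD bounded_opZ mulrDr.
  by congr (_ + _); rewrite mulrCA.
rewrite -[opnorm (_ + _)]mul1r -l1 mulr_suml.
have le i : `|lambda i * y i ((T + mu *: A) (x i))| <=
    lambda i * opnorm (T + mu *: A).
  rewrite normrM gtr0_norm // ler_pM2l //.
  have [x1 _] := Tx i; have [y1 _] := Ty i.
  by apply: (pairing_le S); [rewrite x1|rewrite y1].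
by apply: le_trans (ler_norm_sum _ _ _) _; exact: ler_sum.
Qed.

End ExtremePoints.

Theorem theorem2p4 (R : realType) (K : numFieldType)
    (hK : real_or_complex R K)
    (X Y : completeNormedModType K)
    (reflX : reflexive_space X)
    (fdY : finite_dimensional [set: Y])
    (T : bounded_op X Y) (normT : opnorm T = 1)
    (W : set (bounded_op X Y))
    (subW : linear_subspace W) (fdW : finite_dimensional W) :
  bj_orthogonal_to T W <->
  exists (h : nat) (x : 'I_h -> X) (ystar : 'I_h -> dual Y)
         (lambda : 'I_h -> K),
    [/\ forall i, (norm_attainment T `&` extreme_points (unit_ball X)) (x i),
        forall i, extreme_points (support_functionals (T (x i))) (ystar i),
        forall i, 0 < lambda i,
        \sum_(i < h) lambda i = 1
      & forall A, W A -> \sum_(i < h) lambda i * ystar i (A (x i)) = 0].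
Proof.
have [S] := real_or_complex_scalars hK; split; last first.
  move=> [h [x [y [lambda [xT yT l0 l1 lW]]]]].
  apply: (attaining_pairs_bj_orthogonal S) l0 l1 lW => i; first by case: (xT i).
  by case: (yT i).
move=> TW; have [n [e eW]] := fdW.
have We i : W (e i).
  rewrite eW; exists (fun j => (j == i)%:R).
  rewrite (bigD1 i) //= eqxx scale1r big1 ?addr0 // => j /negPf ->.
  by rewrite scale0r.
have WZ a A : W A -> W (a *: A).
  by move=> WA; rewrite -[_ *: _]addr0; case: subW => W0 WP; exact: WP.
(* Including the multiples by [im_dual S] lets the real parts alone detect that a scalar vanishes,
   by [re_eq0]. *)
pose u (k : 'I_n * bool) := if k.2 then im_dual S *: e k.1 else e k.1.
have Wu k : W (u k) by rewrite /u; case: k.2; [exact: WZ|].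
have /hull_sum[h [phi [c [phiE c0 c1 cphi]]]] :=
  bj_orthogonal_hull S reflX fdY normT subW TW Wu.
have /choice[xy xyE] : forall k, exists z : X * dual Y,
    [/\ extreme_points (unit_ball X) z.1,
        extreme_points [set y : dual Y | opnorm y <= 1] z.2 &
        phi k = fun i => re S (z.2 (oapp u T i z.1))].
  by move=> k; have [x [y xyk]] := phiE k; exists (x, y).
pose x k := (xy k).1; pose y k := (xy k).2.
have x1 k : `|x k| <= 1 by have [[]] := xyE k.
have y1 k : opnorm (y k) <= 1 by have [_ []] := xyE k.
have phiT k : phi k None = re S (y k (T (x k))) by have [_ _ ->] := xyE k.
have phi_le1 k : phi k None <= 1.
  rewrite phiT -[leRHS](re_ofR S) rmorph1 -normT.
  apply: le_trans (re_norm_le S _) _; apply: re_mono; exact: (pairing_le S).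
(* The index [None] stands for [T]. Numbers at most [1] whose average with positive weights is [1]
   are all equal to [1]. *)
have attained k : re S (y k (T (x k))) = 1.
  have /eqP : \sum_j c j * (1 - phi j None) = 0.
    under eq_bigr do rewrite mulrBr mulr1.
    by rewrite sumrB c1 -(cphi None) subrr.
  rewrite psumr_eq0 => [|j _]; last by rewrite mulr_ge0 ?(ltW (c0 j)) ?subr_ge0.
  move=> /allP /(_ k (mem_index_enum _)) /=.
  by rewrite mulf_eq0 gt_eqF // subr_eq0 phiT => /eqP.
have att k := pairing_attained normT (x1 k) (y1 k) (attained k).
exists h, x, y, (fun k => ofR S (c k)); split=> [k|k|k||A].
- by split; [case: (att k)|case: (xyE k)].
- apply: (extreme_points_sub (C := [set y : dual Y | opnorm y <= 1])).
  + by move=> f [/= -> _].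
  + by case: (att k).
  + by case: (xyE k).
- by rewrite -(rmorph0 (ofR S)) ltr_ofR.
- by rewrite -rmorph_sum c1 rmorph1.
have e0 j : \sum_k ofR S (c k) * y k (e j (x k)) = 0.
  have re_sum (b : bool) : re S (\sum_k ofR S (c k) * y k (u (j, b) (x k))) = 0.
    rewrite (big_morph (re S) (reD S) (re0 S)).
    transitivity (\sum_k c k * phi k (Some (j, b))); last by rewrite -cphi.
    by apply: eq_bigr => k _; rewrite reZ; have [_ _ ->] := xyE k.
  apply: (re_eq0 (S := S)); first exact: (re_sum false).
  rewrite -[RHS](re_sum true); congr (re S _); rewrite mulr_sumr.
  apply: eq_bigr => k _.
  by rewrite mulrCA; congr (_ * _); exact: esym (bounded_opZ (y k) _ _).
rewrite eW => -[d ->].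
have lin k : y k ((\sum_j d j *: e j) (x k)) = \sum_j (d j : K) * y k (e j (x k)).
  elim/big_rec2: _ => [|j a B _ <-]; first exact: bounded_op0.
  by rewrite bounded_opDE bounded_opZE bounded_opD bounded_opZ.
under eq_bigr do rewrite lin mulr_sumr.
rewrite exchange_big big1 //= => j _.
under eq_bigr do rewrite mulrCA.
by rewrite -mulr_sumr e0 mulr0.
Qed.
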